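(* Let $2\le k<n$ be integers and let $F=[f_1,\dots,f_n]\in\mathbb{R}_+^{r\times n}$, with $w_{ij}:=f_i^\top f_j$ for $i\ne j$. If feature dominance holds, i.e. there exists a set $I\subset[n]$ with $|I|=k-1$ and $$f_i\ \ge_{\mathrm{cw}}\ \sum_{j\notin I}f_j\qquad\text{for every } i\in I,$$ then the Greedy Feature-Balancing Algorithm, on input $f_1,\dots,f_n$ and $k$, returns an optimal $k$-cut, i.e. a partition of $[n]$ maximizing $\operatorname{Cut}$.
   Context: $[n]=\{1,\dots,n\}$, $\mathbb{R}_+$ denotes the non-negative reals and $\|\cdot\|$ is the Euclidean norm. For $x,y\in\mathbb{R}^r$, $x\ge_{\mathrm{cw}}y$ means $x_p\ge y_p$ for every coordinate $p\in[r]$. For a partition $(A_1,\dots,A_k)$ of $[n]$ into $k$ disjoint (possibly empty) parts, $\operatorname{Cut}(A_1,\dots,A_k)=\sum_{\ell<m}\sum_{i\in A_\ell,\,j\in A_m}w_{ij}$; Max-$k$-Cut asks to maximize this. Greedy Feature-Balancing Algorithm (input: $f_1,\dots,f_n\in\mathbb{R}^r$ with $f_i^\top f_j\ge0$ for $i\neq j$, and $k$). Choose an ordering $(v_1,\dots,v_n)$ of $[n]$ with $\|f_{v_1}\|\ge\|f_{v_2}\|\ge\cdots\ge\|f_{v_n}\|$ (ties broken arbitrarily). Start with $A_1=\cdots=A_k=\emptyset$ and $s_1=\cdots=s_k=0\in\mathbb{R}^r$. For $t=1,\dots,n$: let $v=v_t$; choose $\ell^\star\in\arg\min_{\ell\in[k]}f_v^\top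 s_\ell$ (ties broken arbitrarily); replace $A_{\ell^\star}$ by $A_{\ell^\star}\cup\{v\}$ and $s_{\ell^\star}$ by $s_{\ell^\star}+f_v$. Return $(A_1,\dots,A_k)$. *)

(* Defs.v *)
From HB Require Import structures.
From mathcomp Require Import all_boot all_order all_algebra.
From mathcomp Require Import reals.

Set Implicit Arguments.
Unset Strict Implicit.
Unset Printing Implicit Defensive.
Import Order.TTheory GRing.Theory Num.Theory.
Local Open Scope ring_scope.

Section Vectors.
Variables (R : realType) (r : nat).
Implicit Types x y : 'cV[R]_r.

Definition dotp x y : R := (x^T *m y) 0 0.

(* The Euclidean norm; the library norm on matrices is the sup norm. *)
Definition enorm x : R := Num.sqrt (dotp x x).

Definition cw_ge x y : Prop := forall p, y p 0 <= x p 0.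

End Vectors.

Section Cuts.
Variables (R : realType) (n k : nat).
Implicit Types (w : 'I_n -> 'I_n -> R) (A B : {ffun 'I_k -> {set 'I_n}}).

(* Parts are labelled by 'I_k and may be empty, unlike in [partition]. *)
Definition is_kpartition A : Prop :=
  (forall l m, l != m -> [disjoint A l & A m]) /\ \bigcup_l A l = [set: 'I_n].

Definition cut w A : R :=
  \sum_(l < k) \sum_(m < k | (l < m)%N) \sum_(i in A l) \sum_(j in A m) w i j.

Definition is_optimal_kcut w A : Prop :=
  is_kpartition A /\ forall B, is_kpartition B -> cut w B <= cut w A.

End Cuts.

Definition feature_dominance (R : realType) (r n k : nat)
    (f : 'I_n -> 'cV[R]_r) : Prop :=
  exists I : {set 'I_n}, #|I| = (k - 1)%N /\
    forall i, i \in I -> cw_ge (f i) (\sum_(j | j \notin I) f j).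

Section Greedy.
Variables (R : realType) (r n k : nat) (f : 'I_n -> 'cV[R]_r).

Record greedy_state := GreedyState {
  gparts : {ffun 'I_k -> {set 'I_n}};
  gsums : {ffun 'I_k -> 'cV[R]_r} }.

Definition greedy_init : greedy_state :=
  GreedyState [ffun=> set0] [ffun=> 0].

Definition greedy_add (st : greedy_state) (v : 'I_n) (l : 'I_k) : greedy_state :=
  GreedyState
    [ffun m => if m == l then gparts st m :|: [set v] else gparts st m]
    [ffun m => if m == l then gsums st m + f v else gsums st m].

Definition greedy_argmin (st : greedy_state) (v : 'I_n) (l : 'I_k) : Prop :=
  forall m, dotp (f v) (gsums st l) <= dotp (f v) (gsums st m).

(* A relation rather than a function: any minimizing l may be chosen. *)
Inductive greedy_run : seq 'I_n -> greedy_state -> greedy_state -> Prop :=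
| greedy_run_nil st : greedy_run [::] st st
| greedy_run_cons v vs st l st' :
    greedy_argmin st v l ->
    greedy_run vs (greedy_add st v l) st' ->
    greedy_run (v :: vs) st st'.

Definition greedy_ordering (vs : seq 'I_n) : Prop :=
  perm_eq vs (enum 'I_n) /\
  sorted (fun i j => enorm (f j) <= enorm (f i)) vs.

(* [greedy_returns A]: some resolution of the ties, in the ordering and in the
   successive argmins, makes the algorithm return A. *)
Definition greedy_returns (A : {ffun 'I_k -> {set 'I_n}}) : Prop :=
  exists vs st,
    [/\ greedy_ordering vs, greedy_run vs greedy_init st & gparts st = A].

(* The relation is not vacuous: the algorithm always has a run. *)
Lemma greedy_returns_total : (0 < k)%N -> exists A, greedy_returns A.
Proof.
move=> k_gt0.
have run vs : forall st, exists st', greedy_run vs st st'.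
  elim: vs => [|v vs IH] st; first by exists st; constructor.
  case: (@arg_minP _ _ _ (Ordinal k_gt0) xpredT
           (fun l => dotp (f v) (gsums st l))) => // l _ lmin.
  have [st' st'P] := IH (greedy_add st v l).
  by exists st'; apply: greedy_run_cons st'P => m; apply: lmin.
pose e := fun i j => enorm (f j) <= enorm (f i).
have [st stP] := run (sort e (enum 'I_n)) greedy_init.
exists (gparts st), (sort e (enum 'I_n)), st; split=> //.
split; first by rewrite perm_sort.
by apply: sort_sorted => i j; rewrite /e le_total.
Qed.

End Greedy.

(* Main.v *)
(* Writing s_l for the feature sum of part l, twice the cut is the constant
   |sum_i f_i|^2 minus sum_l |s_l|^2, so an optimal cut minimizes the latter.
   With S the sum of the non-dominating features, every partition satisfies
   sum_l |s_l|^2 >= sum_(i in I) |f_i|^2 + |S|^2: either two dominating vertices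
   share a part and their product is at least |S|^2, or all parts but one contain a
   dominating vertex, against which every other feature there is at least as
   costly as against S.  Greedy attains this bound: some part is always free of
   dominating vertices, so placing a non-dominating vertex costs at most its
   product with the non-dominating features placed before it, and placing a
   dominating vertex costs nothing. *)

Require Import Defs.
From mathcomp Require Import all_boot all_order all_algebra.
From mathcomp Require Import reals.
From mathcomp Require Import lra.
Import Order.TTheory GRing.Theory Num.Theory.
Local Open Scope ring_scope.

Set Implicit Arguments.
Unset Strict Implicit.

(** * Dot products and the coordinatewise order *)

Section DotProduct.
Variables (R : realType) (r : nat).
Implicit Types x y z : 'cV[R]_r.

Lemma dotpE x y : dotp x y = \sum_p x p 0 * y p 0.
Proof. by rewrite /dotp mxE; apply: eq_bigr => p _; rewrite mxE. Qed.

Lemma dotpC x y : dotp x y = dotp y x.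
Proof. by rewrite !dotpE; apply: eq_bigr => p _; rewrite mulrC. Qed.

Lemma dotpDr x y z : dotp x (y + z) = dotp x y + dotp x z.
Proof. by rewrite /dotp mulmxDr mxE. Qed.

Lemma dotpDl x y z : dotp (x + y) z = dotp x z + dotp y z.
Proof. by rewrite dotpC dotpDr !(dotpC z). Qed.

Lemma dotp_sumr T (s : seq T) (P : pred T) (g : T -> 'cV[R]_r) x :
  dotp x (\sum_(i <- s | P i) g i) = \sum_(i <- s | P i) dotp x (g i).
Proof. by rewrite /dotp mulmx_sumr summxE. Qed.

Lemma dotp_suml T (s : seq T) (P : pred T) (g : T -> 'cV[R]_r) x :
  dotp (\sum_(i <- s | P i) g i) x = \sum_(i <- s | P i) dotp (g i) x.
Proof. by rewrite dotpC dotp_sumr; apply: eq_bigr => i _; rewrite dotpC. Qed.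

Lemma dotpxx_ge0 x : 0 <= dotp x x.
Proof. by rewrite dotpE sumr_ge0 // => p _; rewrite -expr2 sqr_ge0. Qed.

Lemma dotpxx_le0 x : dotp x x <= 0 -> x = 0.
Proof.
move=> x_le0; have /eqP : dotp x x = 0 by apply/le_anti; rewrite x_le0 dotpxx_ge0.
rewrite dotpE psumr_eq0; last by move=> p _; rewrite -expr2 sqr_ge0.
move=> /allP x0; apply/matrixP => p q; rewrite (ord1 q) !mxE.
by have := x0 p (mem_index_enum p); rewrite mulf_eq0 orbb => /eqP.
Qed.

Lemma ler_enorm x y : enorm x <= enorm y -> dotp x x <= dotp y y.
Proof. by rewrite /enorm ler_sqrt // dotpxx_ge0. Qed.

Lemma cw_ge_trans y x z : cw_ge x y -> cw_ge y z -> cw_ge x z.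
Proof. by move=> xy yz p; apply: le_trans (yz p) (xy p). Qed.

Lemma cw_ge0_sum T (s : seq T) (P : pred T) (g : T -> 'cV[R]_r) :
  (forall i, P i -> cw_ge (g i) 0) -> cw_ge (\sum_(i <- s | P i) g i) 0.
Proof.
move=> g0 p; rewrite summxE mxE sumr_ge0 // => i Pi.
by have := g0 i Pi p; rewrite mxE.
Qed.

Lemma cw_ge_sum_sub (T : finType) (P Q : pred T) (g : T -> 'cV[R]_r) :
  (forall i, cw_ge (g i) 0) -> (forall i, Q i -> P i) ->
  cw_ge (\sum_(i | P i) g i) (\sum_(i | Q i) g i).
Proof.
move=> g0 QP p; rewrite !summxE [leRHS](bigID Q) /=.
rewrite [X in _ <= X + _](eq_bigl Q); last first.
  by move=> i; apply: andb_idl; apply: QP.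
by rewrite lerDl sumr_ge0 // => i _; have := g0 i p; rewrite mxE.
Qed.

Lemma ler_dotp x x' y y' : cw_ge x 0 -> cw_ge y 0 ->
  cw_ge x' x -> cw_ge y' y -> dotp x y <= dotp x' y'.
Proof.
move=> x0 y0 xx yy; rewrite !dotpE; apply: ler_sum => p _.
by apply: ler_pM => //; [have := x0 p | have := y0 p]; rewrite mxE.
Qed.

Lemma dotp_ge0 x y : cw_ge x 0 -> cw_ge y 0 -> 0 <= dotp x y.
Proof.
move=> x0 y0; rewrite dotpE sumr_ge0 // => p _.
by apply: mulr_ge0; [have := x0 p | have := y0 p]; rewrite mxE.
Qed.

End DotProduct.

(** * Cuts, labellings and the energy of part sums *)

Section CutEnergy.
Variables (R : realType) (r n k : nat) (f : 'I_n -> 'cV[R]_r).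
Implicit Types (g : 'I_n -> 'I_k) (P : {set 'I_n}).

Definition part_sum g P (l : 'I_k) : 'cV[R]_r :=
  \sum_(i in P | g i == l) f i.

Definition energy g P : R :=
  \sum_l dotp (part_sum g P l) (part_sum g P l).

Lemma part_sum_total g P : \sum_l part_sum g P l = \sum_(i in P) f i.
Proof. by rewrite [RHS](partition_big g xpredT). Qed.

Lemma kpartition_labelling (B : {ffun 'I_k -> {set 'I_n}}) :
  is_kpartition B -> exists g, forall l, B l = [set i | g i == l].
Proof.
case=> dis cov.
have mem i : exists l, i \in B l.
  have : i \in \bigcup_l B l by rewrite cov inE.
  by case/bigcupP => l _ il; exists l.
exists (fun i => xchoose (mem i)) => l; apply/setP => i; rewrite inE.
have iB := xchooseP (mem i).
apply/idP/eqP => [il|<- //].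
apply/eqP/negPn/negP => ne.
by have /disjointFr/(_ iB) := dis _ _ ne; rewrite il.
Qed.

Lemma labelling_kpartition g (B : {ffun 'I_k -> {set 'I_n}}) :
  (forall l, B l = [set i | g i == l]) -> is_kpartition B.
Proof.
move=> Bg; split=> [l m lm|].
  rewrite -setI_eq0; apply/eqP/setP => i; rewrite !Bg !inE.
  by apply/andP => -[/eqP-> ]; rewrite (negbTE lm).
by apply/setP => i; rewrite inE; apply/bigcupP; exists (g i); rewrite // Bg inE.
Qed.

(** Expand the right side over ordered pairs of labels: the diagonal is the energy, and by symmetry
    the pairs [l < m] and [m < l] each contribute one cut. Vertices of different parts are distinct,
    so [w] is only evaluated off the diagonal. *)
Lemma cut_energy (w : 'I_n -> 'I_n -> R) g (B : {ffun 'I_k -> {set 'I_n}}) :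
  (forall i j, i != j -> w i j = dotp (f i) (f j)) ->
  (forall l, B l = [set i | g i == l]) ->
  cut w B *+ 2 + energy g [set: 'I_n] = dotp (\sum_i f i) (\sum_i f i).
Proof.
move=> hw Bg; set s := part_sum g [set: 'I_n].
have sE l : s l = \sum_(i in B l) f i.
  by apply: eq_bigl => i; rewrite Bg !inE.
have cutE : cut w B = \sum_(l < k) \sum_(m < k | (l < m)%N) dotp (s l) (s m).
  apply: eq_bigr => l _; apply: eq_bigr => m lm.
  rewrite !sE dotp_suml; apply: eq_bigr => i il.
  rewrite dotp_sumr; apply: eq_bigr => j jm; apply: hw.
  apply: contraTneq lm => ij; move: il jm; rewrite ij !Bg !inE => /eqP-> /eqP->.
  by rewrite ltnn.
have -> : \sum_i f i = \sum_l s l.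
  by rewrite part_sum_total; apply: eq_bigl => i; rewrite inE.
have cutE' : cut w B = \sum_(l < k) \sum_(m < k | (m < l)%N) dotp (s l) (s m).
  rewrite cutE (exchange_big_dep xpredT) //=; apply: eq_bigr => m _.
  by apply: eq_bigr => l _; rewrite dotpC.
rewrite mulr2n {1}cutE cutE' /energy -!big_split /= [RHS]dotp_suml.
apply: eq_bigr => l _; rewrite [RHS]dotp_sumr.
rewrite [RHS](bigID (fun m : 'I_k => (l < m)%N)) /=.
rewrite -addrA; congr (_ + _); rewrite [RHS](bigD1 l) ?ltnn //= addrC.
by congr (_ + _); apply: eq_bigl => m; rewrite -leqNgt ltn_neqAle andbC.
Qed.

Definition relabel g v l : 'I_n -> 'I_k := fun i => if i == v then l else g i.

Lemma part_sum_relabel g P v l m : v \notin P ->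
  part_sum (relabel g v l) (v |: P) m
    = if m == l then part_sum g P m + f v else part_sum g P m.
Proof.
move=> vP; have gP i : i \in P -> relabel g v l i = g i.
  by rewrite /relabel; case: eqP => // ->; rewrite (negbTE vP).
have sumP : \sum_(i in P | relabel g v l i == m) f i = part_sum g P m.
  by apply: eq_bigl => i; case: (boolP (i \in P)) => //= /gP->.
rewrite /part_sum big_mkcondr big_setU1 //= -big_mkcondr sumP.
by rewrite /relabel eqxx (eq_sym l); case: eqP => _; rewrite ?add0r 1?addrC.
Qed.

(** Only part [l] changes, and its square expands. The middle term is twice the quantity that greedy
    minimizes. *)
Lemma energy_relabel g P v l : v \notin P ->
  energy (relabel g v l) (v |: P)
    = energy g P + dotp (f v) (part_sum g P l) *+ 2 + dotp (f v) (f v).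
Proof.
move=> vP; rewrite /energy (bigD1 l) //= [in RHS](bigD1 l) //=.
rewrite (eq_bigr (fun m => dotp (part_sum g P m) (part_sum g P m))); last first.
  by move=> m /negbTE ml; rewrite part_sum_relabel // ml.
rewrite part_sum_relabel // eqxx !dotpDl !dotpDr (dotpC (part_sum _ _ _) (f v)).
by rewrite mulr2n; lra.
Qed.

End CutEnergy.

(** * The lower bound on the energy under feature dominance *)

Section Dominance.
Variables (R : realType) (r n k : nat) (f : 'I_n -> 'cV[R]_r).
Variable I : {set 'I_n}.
Hypothesis f_ge0 : forall i, cw_ge (f i) 0.
Hypothesis cardI : (#|I|.+1 = k)%N.
Hypothesis I_dominates :
  forall i, i \in I -> cw_ge (f i) (\sum_(j | j \notin I) f j).
Implicit Types (g : 'I_n -> 'I_k) (P : {set 'I_n}).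

Lemma sum_f_ge0 (P : pred 'I_n) : cw_ge (\sum_(i | P i) f i) 0.
Proof. by apply: cw_ge0_sum. Qed.

(* The energy of the partition into the singletons of I and its complement,
   restricted to P. *)
Definition dominance_energy P : R :=
  \sum_(i in P | i \in I) dotp (f i) (f i)
  + dotp (\sum_(j in P | j \notin I) f j) (\sum_(j in P | j \notin I) f j).

Lemma dominance_energy_min g :
  dominance_energy [set: 'I_n] <= energy f g [set: 'I_n].
Proof.
pose S := \sum_(j | j \notin I) f j.
pose a l := \sum_(i in I | g i == l) f i.
pose t l := \sum_(j | (j \notin I) && (g j == l)) f j.
have a0 l : cw_ge (a l) 0 by apply: sum_f_ge0.
have t0 l : cw_ge (t l) 0 by apply: sum_f_ge0.
have S0 : cw_ge S 0 by apply: sum_f_ge0.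
have sE l : part_sum f g [set: 'I_n] l = a l + t l.
  rewrite /part_sum (bigID (mem I)) /=; congr (_ + _); apply: eq_bigl => i;
  by rewrite inE /= andbC.
have tS : S = \sum_l t l by rewrite /S (partition_big g xpredT).
have -> : dominance_energy [set: 'I_n] =
    \sum_(i in I) dotp (f i) (f i) + dotp S S.
  rewrite /dominance_energy -/S.
  have -> : \sum_(j in [set: 'I_n] | j \notin I) f j = S.
    by apply: eq_bigl => j; rewrite inE.
  by congr (_ + _); apply: eq_bigl => i; rewrite inE.
have -> : energy f g [set: 'I_n] = \sum_l dotp (a l) (a l) +
    (\sum_l dotp (a l) (t l) *+ 2 + \sum_l dotp (t l) (t l)).
  rewrite -!big_split; apply: eq_bigr => l _ /=.
  by rewrite sE !dotpDl !dotpDr (dotpC (t l)) mulr2n -!addrA.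
have at0 : 0 <= \sum_l dotp (a l) (t l) *+ 2.
  by apply: sumr_ge0 => l _; rewrite mulrn_wge0 // dotp_ge0.
have tt0 : 0 <= \sum_l dotp (t l) (t l).
  by apply: sumr_ge0 => l _; rewrite dotpxx_ge0.
have aE l : dotp (a l) (a l) =
    \sum_(i in I | g i == l) dotp (f i) (a l) by rewrite dotp_suml.
have aaE : \sum_l dotp (a l) (a l) = \sum_(i in I) dotp (f i) (a (g i)).
  rewrite [RHS](partition_big g xpredT) //=; apply: eq_bigr => l _.
  by rewrite aE; apply: eq_bigr => i /andP[_ /eqP->].
have fa i : i \in I -> dotp (f i) (f i) <= dotp (f i) (a (g i)).
  move=> iI; apply: ler_dotp => //.
  rewrite -[X in cw_ge _ X](big_pred1_eq +%R i f).
  by apply: cw_ge_sum_sub => // j /eqP->; rewrite iI eqxx.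
(* Split on whether two dominating vertices [i] and [j] share a label. *)
case: (boolP [exists i in I, exists j in I, (i != j) && (g i == g j)]).
  case/exists_inP => i iI /exists_inP[j jI /andP[ij /eqP gij]].
  suff : \sum_(i in I) dotp (f i) (f i) + dotp S S <= \sum_l dotp (a l) (a l).
    by move=> ?; lra.
  (* The whole of [dotp S S] is charged to vertex [i]: its part sum is at least [f i + f j], and
     [dotp (f i) (f j)] is at least [dotp S S]. *)
  rewrite aaE (bigD1 i) //= [X in _ <= X](bigD1 i) //= addrAC.
  apply: lerD; last by apply: ler_sum => m /andP[mI _]; apply: fa.
  have fij : dotp (f i) (f i) + dotp (f i) (f j) <= dotp (f i) (a (g i)).
    rewrite -dotpDr; apply: ler_dotp => //.
    - by move=> p; have := f_ge0 i p; have := f_ge0 j p; rewrite !mxE; lra.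
    - rewrite /a (bigD1 i) ?iI ?eqxx //= (bigD1 j) /=; last first.
        by rewrite jI gij eqxx eq_sym.
      set rest := (X in f i + (f j + X)).
      have rest0 : cw_ge rest 0 by apply: sum_f_ge0.
      by move=> p; rewrite !mxE lerD2l lerDl; have := rest0 p; rewrite mxE.
  apply: le_trans fij; rewrite lerD2l.
  by apply: ler_dotp => //; apply: I_dominates.
move=> ninj.
have ginj : {in I &, injective g}.
  move=> i j iI jI gij; apply/eqP/negPn/negP => ij; case/negP: ninj.
  apply/exists_inP; exists i => //; apply/exists_inP; exists j => //.
  by rewrite ij gij eqxx.
(* An injective [g] uses [k - 1] labels on [I], so exactly one label [l0] is left without a
   dominating vertex. *)
have /cards1P[l0 l0E] : #|~: (g @: I)| == 1%N.
  rewrite -(eqn_add2l #|g @: I|) cardsC card_ord card_in_imset //.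
  by rewrite addn1 cardI.
have aS l : l != l0 -> cw_ge (a l) S.
  move=> ll0; have : l \in g @: I.
    by apply: contraNT ll0; rewrite -in_setC l0E inE.
  case/imsetP => i iI ->; apply: (@cw_ge_trans _ _ (f i)).
    rewrite -[X in cw_ge _ X](big_pred1_eq +%R i f).
    by apply: cw_ge_sum_sub => // j /eqP->; rewrite iI eqxx.
  exact: I_dominates.
have aa : \sum_(i in I) dotp (f i) (f i) <= \sum_l dotp (a l) (a l).
  by rewrite aaE; apply: ler_sum => i; apply: fa.
apply: lerD => //.
pose T := \sum_(l | l != l0) t l.
have ST : S = t l0 + T by rewrite tS (bigD1 l0).
have T0 : cw_ge T 0 by apply: cw_ge0_sum => l _.
have h1 : dotp S T *+ 2 <= \sum_l dotp (a l) (t l) *+ 2.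
  rewrite (bigD1 l0) //= dotp_sumr -sumrMnl.
  apply: le_trans (_ : \sum_(l | l != l0) dotp (a l) (t l) *+ 2 <= _).
    apply: ler_sum => l ll0; rewrite lerMn2r /=; apply: ler_dotp => //; exact: aS.
  by rewrite lerDr mulrn_wge0 // dotp_ge0.
have h2 : dotp (t l0) (t l0) <= \sum_l dotp (t l) (t l).
  by rewrite (bigD1 l0) //= lerDl sumr_ge0 // => l _; rewrite dotpxx_ge0.
have TT := dotpxx_ge0 T.
move: h1; rewrite ST !dotpDl !dotpDr (dotpC T (t l0)) mulr2n => h1.
lra.
Qed.

(** * Greedy steps and the run invariant *)

(** A dominating vertex opens its own singleton and adds only its square; any other vertex joins the
    common block and also adds a cross term. *)
Lemma dominance_energy_setU1 P v : v \notin P ->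
  dominance_energy (v |: P) = dominance_energy P + dotp (f v) (f v)
    + (if v \in I then 0
       else dotp (f v) (\sum_(j in P | j \notin I) f j) *+ 2).
Proof.
move=> vP; rewrite /dominance_energy.
rewrite !big_mkcondr !big_setU1 //= -!big_mkcondr /=.
case: (v \in I) => /=; first by rewrite add0r; lra.
set t := \sum_(j in P | j \notin I) f j.
by rewrite !dotpDl !dotpDr (dotpC t) mulr2n; lra.
Qed.

Lemma part_sum_le_nondominating g P l : l \notin g @: (I :&: P) ->
  cw_ge (\sum_(j in P | j \notin I) f j) (part_sum f g P l).
Proof.
move=> lI; apply: cw_ge_sum_sub => // i /andP[iP /eqP gi]; rewrite iP /=.
by apply: contra lI => iI; rewrite -gi imset_f // inE iI.
Qed.

Lemma exists_dominating_free_label g P : exists l, l \notin g @: (I :&: P).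
Proof.
have : (#|g @: (I :&: P)| < k)%N.
  rewrite -[leqRHS]cardI ltnS (leq_trans (leq_imset_card _ _)) //.
  by rewrite subset_leq_card ?subsetIl.
rewrite -[X in (_ < X)%N]card_ord -(cardsC (g @: (I :&: P))) -[ltnLHS]addn0.
by rewrite ltn_add2l; case/card_gt0P => l; rewrite inE; exists l.
Qed.

(** As [v] itself is not yet placed, at most [k - 2] dominating vertices are, so two of the [k]
    labels avoid them. *)
Lemma exists_two_dominating_free_labels g P v : v \in I -> v \notin P ->
  exists l m, [/\ l \notin g @: (I :&: P), m \notin g @: (I :&: P) & l != m].
Proof.
move=> vI vP; have : (#|g @: (I :&: P)|.+1 < k)%N.
  rewrite -[leqRHS]cardI ltnS (leq_ltn_trans (leq_imset_card _ _)) //.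
  apply/proper_card/properP; split; first exact: subsetIl.
  by exists v; rewrite // inE (negbTE vP) andbF.
rewrite -[X in (_ < X)%N]card_ord -(cardsC (g @: (I :&: P))) -addn1.
rewrite ltn_add2l; case/card_gt1P => l [m [lI mI lm]].
by exists l, m; rewrite !inE in lI mI.
Qed.

(* A non-dominating j can only precede v in I in case of a tie, and then
   |S| <= |f v| <= |f j| forces all other non-dominating features to vanish:
   of two parts free of dominating vertices, the one avoiding j has zero sum. *)
Lemma greedy_dominating_step g P v l : v \in I -> v \notin P ->
  (forall u, u \in P -> dotp (f v) (f v) <= dotp (f u) (f u)) ->
  (forall m, dotp (f v) (part_sum f g P l) <= dotp (f v) (part_sum f g P m)) ->
  dotp (f v) (part_sum f g P l) <= 0.
Proof.
move=> vI vP big_P lmin.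
have [a [b [aI bI ab]]] := exists_two_dominating_free_labels g vI vP.
(* If [P] has no non-dominating vertex, then part [a] is empty and its zero sum bounds the
   minimum. *)
case: (pickP [pred j in P | j \notin I]) => [j /andP[/= jP jI]|noJ]; last first.
  apply: le_trans (lmin a) _.
  rewrite (_ : part_sum f g P a = 0) ?dotpE ?big1 // => [p _|].
    by rewrite mxE mulr0.
  apply: big1 => i /andP[iP /eqP gi]; case/negP: aI; rewrite -gi imset_f //.
  by rewrite inE iP andbT; have := noJ i; rewrite /= iP => /negbFE.
have [c cI cj] : exists2 c, c \notin g @: (I :&: P) & g j != c.
  by case: (eqVneq (g j) a) => [->|]; [exists b | exists a].
pose U := \sum_(i | (i \notin I) && (i != j)) f i.
have U0 : cw_ge U 0 by apply: sum_f_ge0.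
have SE : \sum_(i | i \notin I) f i = f j + U by rewrite (bigD1 j).
have Uz : U = 0.
  apply: dotpxx_le0.
  have h1 : dotp (f j + U) (f j + U) <= dotp (f v) (f v).
    by rewrite -SE; apply: ler_dotp; do ?[exact: sum_f_ge0 | exact: I_dominates].
  have h2 := big_P _ jP.
  have h3 : 0 <= dotp (f j) U by apply: dotp_ge0.
  move: h1; rewrite !dotpDl !dotpDr (dotpC U (f j)); lra.
apply: le_trans (lmin c) _.
apply: le_trans (_ : dotp (f v) U <= 0); last first.
  by rewrite Uz dotpE big1 // => p _; rewrite mxE mulr0.
apply: ler_dotp => //; first exact: sum_f_ge0.
apply: cw_ge_sum_sub => // i /andP[iP /eqP gi].
rewrite (contraNneq _ cj) ?andbT; last by move=> <-; rewrite gi.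
by apply: contra cI => iI; rewrite -gi imset_f // inE iI.
Qed.

(** Both sides gain the square of [f v], so only cross terms compete. For [v] outside [I],
    minimality of [l] allows comparison with a part free of dominating vertices, whose sum lies
    below that of all non-dominating features in [P]. *)
Lemma greedy_step g P v l : v \notin P ->
  (forall u, u \in P -> dotp (f v) (f v) <= dotp (f u) (f u)) ->
  (forall m, dotp (f v) (part_sum f g P l) <= dotp (f v) (part_sum f g P m)) ->
  energy f g P <= dominance_energy P ->
  energy f (relabel g v l) (v |: P) <= dominance_energy (v |: P).
Proof.
move=> vP big_P lmin leP.
rewrite energy_relabel // dominance_energy_setU1 //.
case: ifP => vI.
  by have := greedy_dominating_step vI vP big_P lmin; lra.
have [m mI] := exists_dominating_free_label g P.
have : dotp (f v) (part_sum f g P m)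
    <= dotp (f v) (\sum_(j in P | j \notin I) f j).
  apply: ler_dotp => //; first exact: sum_f_ge0.
  exact: part_sum_le_nondominating.
by have := lmin m; lra.
Qed.

(** [P] is the set of vertices placed so far; the labelling [g] is total, but its values outside [P]
    are arbitrary. *)
Definition greedy_invariant P (st : greedy_state R r n k) : Prop :=
  exists g, [/\ forall l, gparts st l = [set i in P | g i == l],
    forall l, gsums st l = part_sum f g P l
    & energy f g P <= dominance_energy P].

Lemma greedy_invariant_add P st v l : v \notin P ->
  (forall u, u \in P -> enorm (f v) <= enorm (f u)) ->
  greedy_argmin f st v l -> greedy_invariant P st ->
  greedy_invariant (v |: P) (greedy_add f st v l).
Proof.
move=> vP big_P lmin [g [gP gS leP]]; exists (relabel g v l); split.
- move=> m; rewrite ffunE !gP; apply/setP => i; rewrite /relabel.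
  have [->|iv] := eqVneq i v; rewrite !inE ?eqxx /=.
    by rewrite (eq_sym l); case: ifP; rewrite !inE ?(negbTE vP) ?eqxx ?orbT.
  by case: ifP => ml; rewrite !inE (negbTE iv) ?orbF.
- by move=> m; rewrite ffunE part_sum_relabel // !gS.
- apply: greedy_step => // [u /big_P /ler_enorm //|m].
  by have := lmin m; rewrite !gS.
Qed.

(** Induction on the run needs an arbitrary starting set [P]; the norm comparison between [P] and
    [vs] carries the sorted order across the split. *)
Lemma greedy_run_invariant vs st st' P :
  greedy_run f vs st st' ->
  sorted (fun i j => enorm (f j) <= enorm (f i)) vs -> uniq vs ->
  (forall v, v \in vs -> v \notin P) ->
  (forall u v, u \in P -> v \in vs -> enorm (f v) <= enorm (f u)) ->
  greedy_invariant P st -> greedy_invariant (P :|: [set v in vs]) st'.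
Proof.
move=> run; elim: run P => {vs st st'} [st|v vs st l st' lmin _ IH] P.
  move=> _ _ _ _; rewrite (_ : P :|: _ = P) //; apply/setP => i.
  by rewrite !inE orbF.
rewrite /= (path_sortedE (fun _ _ _ ab bc => le_trans bc ab)).
move=> /andP[/allP vbig svs] /andP[vvs uvs] disP bigP invP.
rewrite (_ : P :|: _ = (v |: P) :|: [set u in vs]); last first.
  by apply/setP => i; rewrite !inE orbA (orbC (i \in P)).
apply: IH => //.
- move=> u uvs'; rewrite !inE negb_or disP ?inE ?uvs' ?orbT // andbT.
  by apply: contraNneq vvs => <-.
- move=> u w; rewrite !inE => /orP[/eqP->|uP] wvs; first exact: vbig.
  by apply: bigP; rewrite // inE wvs orbT.
- apply: greedy_invariant_add => //; first by rewrite disP ?inE ?eqxx.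
  by move=> u uP; apply: bigP; rewrite // inE eqxx.
Qed.

Lemma greedy_energy (A : {ffun 'I_k -> {set 'I_n}}) : greedy_returns f A ->
  exists2 g, forall l, A l = [set i | g i == l]
    & energy f g [set: 'I_n] <= dominance_energy [set: 'I_n].
Proof.
case=> vs [st [[perm_vs sorted_vs] run <-]].
have mem_vs i : i \in vs by rewrite (perm_mem perm_vs) mem_enum.
have uniq_vs : uniq vs by rewrite (perm_uniq perm_vs) enum_uniq.
(* An arbitrary label for the still unplaced vertices; one exists because [k] is a successor. *)
have l0 : 'I_k by rewrite -cardI; exact: ord0.
have init : greedy_invariant set0 (greedy_init R r n k).
  exists (fun=> l0).
  have sum0 l : part_sum f (fun=> l0) set0 l = 0.
    by apply: big1 => i; rewrite inE.
  split=> [l|l|]; first by rewrite ffunE; apply/setP => i; rewrite !inE.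
    by rewrite ffunE sum0.
  rewrite /energy big1 => [|l _].
    by rewrite addr_ge0 ?dotpxx_ge0 // sumr_ge0 // => i _; apply: dotpxx_ge0.
  by rewrite sum0 dotpE big1 // => p _; rewrite mxE mulr0.
have [||g] := greedy_run_invariant run sorted_vs uniq_vs _ _ init.
- by move=> v _; rewrite inE.
- by move=> u v; rewrite inE.
rewrite (_ : _ :|: _ = [set: 'I_n]); last first.
  by apply/setP => i; rewrite !inE mem_vs.
by case=> gA _ le_g; exists g => // l; rewrite gA; apply/setP => i; rewrite !inE.
Qed.


End Dominance.

(** * Optimality of the greedy cut *)

Unset Implicit Arguments.

Theorem proposition12 (R : realType) (r n k : nat) (F : 'M[R]_(r, n))
    (w : 'I_n -> 'I_n -> R)
    (hk : (2 <= k)%N) (hkn : (k < n)%N)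
    (hF : forall p i, 0 <= F p i)
    (hw : forall i j, i != j -> w i j = dotp (col i F) (col j F))
    (hdom : feature_dominance k (fun i => col i F))
    (A : {ffun 'I_k -> {set 'I_n}})
    (hA : greedy_returns (fun i => col i F) A) :
  is_optimal_kcut w A.
Proof.
have [I [cardI domI]] := hdom.
have kI : #|I|.+1 = k by rewrite cardI subn1 prednK // (ltn_trans _ hk).
have f0 i : cw_ge (col i F) 0 by move=> p; rewrite !mxE hF.
have [g gA le_g] := greedy_energy f0 kI domI hA.
split=> [|B /kpartition_labelling[h hB]]; first exact: labelling_kpartition gA.
(* The energy of [g] is at most [dominance_energy], which is at most that of [h]. Twice the cut plus
   the energy is the same constant for [A] and [B], so the cuts compare the other way. *)
have := dominance_energy_min f0 kI domI h.
by have := cut_energy hw gA; rewrite -(cut_energy hw hB) !mulr2n; lra.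
Qed.
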